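(* Let $k$ be a field with $\operatorname{char}k\neq2$. A smooth quadric hypersurface $Q^4\subset\mathbb{P}^5$ over $k$ contains a Veronese surface (defined over $k$) if and only if, in suitable linear coordinates, its equation can be written as $$Q^4_{a,b}=\bigl(x_0x_5=x_1^2+ax_2^2+bx_3^2+abx_4^2\bigr)$$ for some $a,b\in k^*$. Up to coordinate changes by $\mathrm{Aut}(\mathbb{P}^2)\times\mathrm{Aut}(Q^4_{a,b})$, the quadric $Q^4_{a,b}$ contains a unique Veronese surface; a representative is the image of $$(u:v:w)\mapsto\bigl(u^2+aw^2:\ uv:\ vw:\ uw:\ w^2:\ v^2+bw^2\bigr).$$
   Context: A Veronese surface in $\mathbb{P}^5$ is the image of $\mathbb{P}^2\to\mathbb{P}^5$, $(u:v:w)\mapsto(u^2:v^2:w^2:uv:vw:uw)$, composed with an automorphism of $\mathbb{P}^5$. *)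

(* Defs.v *)
From HB Require Import structures.
From mathcomp Require Import all_boot all_algebra.
From mathcomp.multinomials Require Import mpoly.
Set Implicit Arguments. Unset Strict Implicit. Unset Printing Implicit Defensive.
Import GRing.Theory.
Local Open Scope ring_scope.

(* Conventions: points of P^n are row vectors; a quadric in P^5 is given by a
   symmetric matrix M, with equation x M x^T = 0 (char k <> 2). *)

Notation P3 k := {mpoly k[3]}.

Definition liftmx (k : fieldType) (m n : nat) (A : 'M[k]_(m, n)) : 'M[P3 k]_(m, n) :=
  map_mx (fun c => c%:MP_[3]) A.

Definition Xrow (k : fieldType) : 'rV[P3 k]_3 := \row_(i < 3) 'X_i.

Definition veron (R : comNzRingType) (x : 'rV[R]_3) : 'rV[R]_6 :=
  let u := x 0 0 in let v := x 0 1 in let w := x 0 2%:R in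
  \row_(i < 6) nth 0 [:: u ^+ 2; v ^+ 2; w ^+ 2; u * v; v * w; u * w] i.

(* the parametrized surface f (row of 6 quadratic forms in u,v,w) lies on the
   quadric with matrix M: the quartic f M f^T vanishes identically *)
Definition on_quadric (k : fieldType) (M : 'M[k]_6) (f : 'rV[P3 k]_6) : Prop :=
  f *m liftmx M *m f^T = 0.

Definition is_veronese (k : fieldType) (f : 'rV[P3 k]_6) : Prop :=
  exists A : 'M[k]_6, A \in unitmx /\ f = veron (Xrow k) *m liftmx A.

(* matrix of Q_{a,b}: x0 x5 - x1^2 - a x2^2 - b x3^2 - ab x4^2 *)
Definition Qab (k : fieldType) (a b : k) : 'M[k]_6 :=
  \matrix_(i < 6, j < 6)
    if ((i == 0 :> nat) && (j == 5 :> nat)) || ((i == 5 :> nat) && (j == 0 :> nat))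
    then 2^-1
    else if i == j then - nth 0 [:: 0; 1; a; b; a * b; 0] i else 0.

Definition psi (k : fieldType) (a b : k) : 'rV[P3 k]_6 :=
  let u : P3 k := 'X_0 in let v : P3 k := 'X_1 in let w : P3 k := 'X_2%:R in
  \row_(i < 6) nth 0 [:: u ^+ 2 + a%:MP_[3] * w ^+ 2; u * v; v * w; u * w; w ^+ 2;
                         v ^+ 2 + b%:MP_[3] * w ^+ 2] i.

Definition preserves (k : fieldType) (M T : 'M[k]_6) : Prop :=
  T \in unitmx /\ exists c : k, c != 0 /\ T *m M *m T^T = c *: M.

(* Main.v *)
Require Import Defs.
From HB Require Import structures.
From mathcomp Require Import all_boot all_algebra.
From mathcomp Require Import ring.
From mathcomp.multinomials Require Import mpoly.
Import GRing.Theory.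
Local Open Scope ring_scope.
Set Implicit Arguments. Unset Strict Implicit. Unset Printing Implicit Defensive.

(** The quadrics through the standard Veronese surface are spanned by the 2 x 2
    minors of a symmetric 3 x 3 matrix Y, so they have the form tr (C adj Y) with
    C a ternary symmetric matrix; a coordinate change h of P^2 acts on C by
    congruence with the cofactor matrix of h.  Diagonalising C as a multiple of
    diag (a, b, 1) puts the quadric in the form Q_{a,b}, with psi_{a,b} as the
    Veronese parametrisation.  For uniqueness, if Q_{a',b'} is similar to Q_{a,b},
    Witt cancellation of a hyperbolic plane makes the Pfister forms <1,a,b,ab>
    and <1,a',b',a'b'> similar, hence isometric because the quaternion norm is
    multiplicative; cancelling <1> shows that <a,b,ab> and <a',b',a'b'> are
    isometric, so diag (a, b, 1) and diag (a', b', 1) are similar, and this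
    similarity is the required change of coordinates of P^2. *)

(** * Congruence of symmetric matrices *)

Definition cong (k : fieldType) n (M N : 'M[k]_n) : Prop :=
  exists2 T : 'M[k]_n, T \in unitmx & T *m M *m T^T = N.

Section Congruence.
Variable k : fieldType.

Lemma cong_refl n (M : 'M[k]_n) : cong M M.
Proof. by exists 1%:M; rewrite ?unitmx1 // trmx1 mul1mx mulmx1. Qed.

Lemma cong_sym n (M N : 'M[k]_n) : cong M N -> cong N M.
Proof.
case=> T Tu <-; exists (invmx T); first by rewrite unitmx_inv.
by rewrite !mulmxA mulVmx // mul1mx -mulmxA -trmx_mul mulVmx // trmx1 mulmx1.
Qed.

Lemma cong_trans n (N M P : 'M[k]_n) : cong M N -> cong N P -> cong M P.
Proof.
case=> T Tu <- [S Su <-]; exists (S *m T); first by rewrite unitmx_mul Su.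
by rewrite trmx_mul !mulmxA.
Qed.

Lemma congZ n (c : k) (M N : 'M[k]_n) : cong M N -> cong (c *: M) (c *: N).
Proof. by case=> T Tu <-; exists T => //; rewrite -scalemxAr -scalemxAl. Qed.

(** Invertibility of [N] forces that of [T], so an explicit [T] needs no inverse or determinant. *)
Lemma cong_of_mul n (T M N : 'M[k]_n) :
  N \in unitmx -> T *m M *m T^T = N -> cong M N.
Proof.
move=> Nu e; exists T => //.
by move: Nu; rewrite -e !unitmx_mul => /andP[/andP[]].
Qed.

Lemma cong_unit n (M N : 'M[k]_n) : cong M N -> M \in unitmx -> N \in unitmx.
Proof. by case=> T Tu <- Mu; rewrite !unitmx_mul unitmx_tr Tu Mu. Qed.

(** Entries beyond the end of [s] default to 0; in particular [[::]] encodes the zero form. *)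
Definition dg n (s : seq k) : 'M[k]_n := diag_mx (\row_(i < n) s`_i).

Lemma dg_cons n a s : dg n.+1 (a :: s) = block_mx a%:M 0 0 (dg n s) :> 'M_(1 + n).
Proof.
rewrite /dg -(_ : diag_mx (a%:M : 'rV_1) = a%:M); last first.
  by rewrite (mx11_scalar (diag_mx _)) !mxE.
rewrite -diag_mx_row; congr diag_mx; apply/rowP => i; rewrite !mxE.
case: (splitP i) => j e; rewrite !mxE e ?add1n //=.
by rewrite !ord1.
Qed.

Lemma dg_unit n s :
  size s = n -> all (fun x => x != 0) s -> dg n s \in unitmx.
Proof.
move=> sn /allP s0; rewrite unitmxE det_diag unitfE; apply/prodf_neq0 => i _.
by rewrite mxE; apply/s0/mem_nth; rewrite sn.
Qed.

Lemma tr_dg n s : (dg n s)^T = dg n s.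
Proof. exact: tr_diag_mx. Qed.

Hypothesis two_neq0 : 2%:R != 0 :> k.

(* Composing [T] with the reflection taking its first row to [- e_0] makes it
   block diagonal; [D - (1 + t)^-1 c r] is the resulting lower block. *)
Lemma witt_cancel n (a : k) (G1 G2 : 'M[k]_n) :
  G1^T = G1 -> G2 \in unitmx ->
  cong (block_mx a%:M 0 0 G1 : 'M_(1 + n)) (block_mx a%:M 0 0 G2) -> cong G1 G2.
Proof.
move=> Gs G2u [T _].
(* If the corner entry of [T] is -1, that of [- T] is 1, and 1 + 1 is nonzero. *)
wlog: T / T 0 0 + 1 != 0.
  move=> W; have [tN|] := eqVneq (T 0 0 + 1) 0; last exact: W.
  move=> e; apply: (W (- T)); last by rewrite linearN /= mulNmx mulmxN mulNmx opprK.
  rewrite mxE; move: tN => /eqP; rewrite addr_eq0 => /eqP ->.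
  by rewrite opprK.
have eT : T = block_mx (ulsubmx (T : 'M_(1 + n))) (ursubmx (T : 'M_(1 + n)))
                       (dlsubmx (T : 'M_(1 + n))) (drsubmx (T : 'M_(1 + n))).
  by rewrite submxK.
have eT0 : T 0 0 = (ulsubmx (T : 'M_(1 + n))) 0 0.
  by rewrite !mxE; congr (T _ _); apply: val_inj.
rewrite eT0; move: eT.
move: (ulsubmx _) (ursubmx _) (dlsubmx _) (drsubmx _) => t r c D -> {eT0 T}.
rewrite [t]mx11_scalar; move: (t 0 0) => {}t; rewrite mxE eqxx mulr1n => t1.
rewrite tr_block_mx !mulmx_block !(mulmx0, mul0mx, addr0, add0r) tr_scalar_mx.
case/eq_block_mx => e1 _ e3 e4.
have {}e1 : r *m G1 *m r^T = (a * (1 - t ^+ 2))%:M.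
  move: e1; rewrite -!scalar_mxM => /(canRL (addKr _)) ->.
  by rewrite -raddfN -raddfD; congr (_%:M); ring.
have {}e3 : D *m G1 *m r^T = - (a * t) *: c.
  move/(canRL (addKr _)): e3 => ->; rewrite addr0 -mulmxA -scalar_mxM mul_mx_scalar.
  by rewrite scaleNr.
have e3' : r *m G1 *m D^T = - (a * t) *: c^T.
  by rewrite -[RHS]linearZ -e3 /= !trmx_mul trmxK Gs mulmxA.
pose s := - (t + 1)^-1.
apply: (@cong_of_mul _ (D + s *: (c *m r))) => //.
have -> : (D + s *: (c *m r)) *m G1 *m (D + s *: (c *m r))^T =
  D *m G1 *m D^T + s *: (D *m G1 *m r^T *m c^T)
  + s *: (c *m (r *m G1 *m D^T)) + s ^+ 2 *: (c *m (r *m G1 *m r^T) *m c^T).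
  rewrite linearD linearZ /= trmx_mul !mulmxDl !mulmxDr -?scalemxAl -?scalemxAr -?scalemxAl.
  by rewrite scalerA -!mulmxA !addrA expr2.
(* All corrections are multiples of [c *m c^T]; their total coefficient -2ats + s^2 a(1 - t^2)
   equals a, as in [e4]. *)
rewrite e1 e3 e3' -e4 mul_mx_scalar -!scalemxAr -!scalemxAl -!mulmxA.
rewrite mul_scalar_mx -scalemxAr !scalerA -!addrA addrC -!addrA.
rewrite !addrA -!scalerDl; congr (_ *: _ + _); by rewrite /s; field.
Qed.

Lemma dg_cancel n (a : k) (s t : seq k) : size t = n -> all (fun x => x != 0) t ->
  cong (dg n.+1 (a :: s)) (dg n.+1 (a :: t)) -> cong (dg n s) (dg n t).
Proof.
move=> tn t0; rewrite !dg_cons; apply: witt_cancel => //; first exact: tr_dg.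
exact: dg_unit.
Qed.

(** A nonzero diagonal entry is permuted to the top. If the diagonal vanishes, adding row and column
    [j] to row and column [i] creates the diagonal entry 2 [G i j]. *)
Lemma diag_neq0_congr n (G : 'M[k]_n.+1) : G^T = G -> G != 0 ->
  exists2 T : 'M[k]_n.+1, T \in unitmx & (T *m G *m T^T) 0 0 != 0.
Proof.
move=> Gs G0.
have diag (H : 'M[k]_n.+1) i : H i i != 0 ->
    exists2 T : 'M[k]_n.+1, T \in unitmx & (T *m H *m T^T) 0 0 != 0.
  move=> Hi; exists (tperm_mx 0 i); first exact: unitmx_perm.
  by rewrite tr_tperm_mx -xcolE -xrowE !mxE perm.tpermL.
have [i Gi|Gd] := pickP (fun i => G i i != 0); first exact: (diag G i).
have [[i j] /= Gij|G00] := pickP (fun p : 'I_n.+1 * 'I_n.+1 => G p.1 p.2 != 0);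
  last by case/eqP: G0; apply/matrixP => i j; rewrite mxE; apply/eqP/negbFE/(G00 (i, j)).
have nij : i != j by apply: contraNneq Gij => ->; move: (Gd j) => /negbFE.
pose T : 'M[k]_n.+1 := 1%:M + delta_mx i j.
have Tu : T \in unitmx.
  apply: (proj1 (mulmx1_unit (_ : T *m (1%:M - delta_mx i j) = 1%:M))).
  rewrite mulmxDl mul1mx mulmxBr mulmx1 mul_delta_mx_cond eq_sym (negPf nij) subr0.
  by rewrite subrK.
have TA (A : 'M[k]_n.+1) a b : (T *m A) a b = A a b + (a == i)%:R * A j b.
  rewrite mulmxDl mul1mx mxE; congr (_ + _).
  rewrite mxE (bigD1 j) //= mxE eqxx andbT big1 ?addr0 // => l lj.
  by rewrite mxE (negPf lj) andbF mul0r.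
have [S Su H] : exists2 S : 'M[k]_n.+1, S \in unitmx &
    (S *m (T *m G *m T^T) *m S^T) 0 0 != 0.
  apply: (diag _ i).
  have -> : (T *m G *m T^T) i i = G i j *+ 2.
    have Gji : G j i = G i j by rewrite -[in LHS]Gs mxE.
    have [/negbFE/eqP Gii /negbFE/eqP Gjj] := (Gd i, Gd j).
    rewrite -[T *m G]trmxK -trmx_mul mxE TA ![_^T _ _]mxE !TA eqxx !mul1r.
    by rewrite Gii Gjj Gji add0r addr0 mulr2n.
  by rewrite -mulr_natr mulf_neq0.
exists (S *m T); first by rewrite unitmx_mul Su.
by rewrite trmx_mul !mulmxA in H *.
Qed.

(** Induction on the size: with a nonzero pivot [a], completing the square leaves the Schur
    complement [D - a^-1 *: (c *m c^T)]. *)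
Lemma cong_diag n (G : 'M[k]_n) : G^T = G -> exists s, cong G (dg n s).
Proof.
elim: n G => [|n IHn] G Gs;
  first by exists [::]; rewrite [dg _ _]flatmx0 [G]flatmx0; apply: cong_refl.
have [->|G0] := eqVneq G 0.
  exists [::]; rewrite (_ : dg _ _ = 0); first exact: cong_refl.
  by apply/matrixP => i j; rewrite !mxE nth_nil mul0rn.
have [T Tu] := diag_neq0_congr Gs G0.
have: cong G (T *m G *m T^T) by exists T.
have: (T *m G *m T^T)^T = T *m G *m T^T by rewrite !trmx_mul trmxK Gs mulmxA.
move: (T *m G *m T^T) => {Tu G0 Gs}H Hs GH H00.
suff [s Hd] : exists s, cong H (dg n.+1 s) by exists s; apply: cong_trans GH Hd.
pose a := H 0 0; pose c := @dlsubmx _ 1 n 1 n H; pose D := @drsubmx _ 1 n 1 n H.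
have HE : H = block_mx a%:M c^T c D :> 'M_(1 + n).
  rewrite -[LHS](@submxK _ 1 n 1 n); congr (@block_mx _ 1 n 1 n _ _ _ _).
    by rewrite [LHS]mx11_scalar !mxE; congr (H _ _)%:M; apply: val_inj.
  by rewrite /c trmx_dlsub Hs.
have Ds : D^T = D by rewrite trmx_drsub Hs.
have [|s [S Su DS]] := IHn (D - a^-1 *: (c *m c^T)).
  by rewrite linearB linearZ /= trmx_mul trmxK Ds.
exists (a :: s); rewrite dg_cons.
pose U : 'M[k]_(1 + n) := block_mx 1%:M 0 (- a^-1 *: (S *m c)) S.
change (@cong k (1 + n) H (block_mx a%:M 0 0 (dg n s))).
exists U; first by rewrite unitmxE det_lblock det1 mul1r -unitmxE.
rewrite HE /U tr_block_mx !mulmx_block !trmx1 !trmx0.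
rewrite !(mul1mx, mulmx1, mul0mx, mulmx0, addr0, add0r) -DS.
have e0 : - a^-1 *: (S *m c) *m a%:M + S *m c = 0.
  by rewrite mul_mx_scalar scalerA mulrN divff // scaleN1r addNr.
rewrite e0 mul0mx add0r; congr (@block_mx _ 1 n 1 n _ _ _ _).
  by rewrite -[LHS]trmxK linearD /= !trmx_mul !trmxK tr_scalar_mx e0 trmx0.
rewrite mulmxBr mulmxBl mulmxDl addrC -!scalemxAr -!scalemxAl.
by rewrite scaleNr !mulmxA.
Qed.
End Congruence.

(** * Matrices of size 3 and 6 *)

Notation o6 i := (@Ordinal 6 i isT).

Definition mxs (R : nzRingType) m n (l : seq (seq R)) : 'M[R]_(m, n) :=
  \matrix_(i, j) (nth [::] l i)`_j.

Lemma big_ord3 (R : nzRingType) (F : 'I_3 -> R) :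
  \sum_(i < 3) F i = F 0 + F 1 + F 2%:R.
Proof.
rewrite !big_ord_recr big_ord0 /= add0r.
by congr (F _ + F _ + F _); apply: val_inj.
Qed.

Lemma big_ord6 (R : nzRingType) (F : 'I_6 -> R) :
  \sum_(i < 6) F i = F (o6 0) + F (o6 1)
    + F (o6 2) + F (o6 3) + F (o6 4)
    + F (o6 5).
Proof.
rewrite !big_ord_recr big_ord0 /= add0r.
by congr (F _ + F _ + F _ + F _ + F _ + F _); apply: val_inj.
Qed.

Lemma ord3P (P : 'I_3 -> Prop) : P 0 -> P 1 -> P 2%:R -> forall i, P i.
Proof.
move=> P0 P1 P2 [[|[|[|//]]] p].
- by rewrite (_ : Ordinal p = 0) //; apply: val_inj.
- by rewrite (_ : Ordinal p = 1) //; apply: val_inj.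
- by rewrite (_ : Ordinal p = 2%:R) //; apply: val_inj.
Qed.

Lemma ord6P (P : 'I_6 -> Prop) :
  P (o6 0) -> P (o6 1) -> P (o6 2) ->
  P (o6 3) -> P (o6 4) -> P (o6 5) ->
  forall i, P i.
Proof.
by move=> ? ? ? ? ? ? [[|[|[|[|[|[|//]]]]]] p]; rewrite (bool_irrelevance p isT).
Qed.

Lemma mulmx6E (R : nzRingType) (F G : nat -> nat -> R) :
  (\matrix_(i < 6, j < 6) F i j) *m (\matrix_(i < 6, j < 6) G i j) =
  \matrix_(i < 6, j < 6) (F i 0%N * G 0%N j + F i 1%N * G 1%N j + F i 2%N * G 2%N j
    + F i 3%N * G 3%N j + F i 4%N * G 4%N j + F i 5%N * G 5%N j).
Proof. by apply/matrixP => i j; rewrite mxE big_ord6 !mxE. Qed.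

(** Entries are functions of [nat] indices, so for literal [i] and [j] they reduce by computation to
    terms that [ring] accepts. *)
Lemma congr6E (R : nzRingType) (F G : nat -> nat -> R) (i j : 'I_6) :
  let F' := \matrix_(i < 6, j < 6) F i j in
  let r l := F i 0%N * G 0%N l + F i 1%N * G 1%N l + F i 2%N * G 2%N l +
             F i 3%N * G 3%N l + F i 4%N * G 4%N l + F i 5%N * G 5%N l in
  (F' *m (\matrix_(i < 6, j < 6) G i j) *m F'^T) i j =
  r 0%N * F j 0%N + r 1%N * F j 1%N + r 2%N * F j 2%N +
  r 3%N * F j 3%N + r 4%N * F j 4%N + r 5%N * F j 5%N.
Proof.
have mE (A B : 'M[R]_6) a b : (A *m B) a b = \sum_l A a l * B l b by rewrite mxE.
by move=> F1 r; rewrite mE big_ord6 !mE !big_ord6 !mxE.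
Qed.

Lemma quad6E (R : nzRingType) (F : nat -> R) (M : 'M[R]_6) :
  let v := \row_(i < 6) F i in
  let r j := F 0%N * M (o6 0) j + F 1%N * M (o6 1) j + F 2%N * M (o6 2) j +
             F 3%N * M (o6 3) j + F 4%N * M (o6 4) j + F 5%N * M (o6 5) j in
  (v *m M *m v^T) 0 0 =
  r (o6 0) * F 0%N + r (o6 1) * F 1%N + r (o6 2) * F 2%N +
  r (o6 3) * F 3%N + r (o6 4) * F 4%N + r (o6 5) * F 5%N.
Proof.
move=> v r; rewrite mxE big_ord6.
have vM j : (v *m M) 0 j = r j by rewrite mxE big_ord6 !mxE.
by rewrite !vM !mxE.
Qed.

Lemma sym6E (R : nzRingType) (N : 'M[R]_6) : N^T = N ->
  (N (o6 1) (o6 0) = N (o6 0) (o6 1)) * (N (o6 2) (o6 0) = N (o6 0) (o6 2)) *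
  (N (o6 2) (o6 1) = N (o6 1) (o6 2)) *
  (N (o6 3) (o6 0) = N (o6 0) (o6 3)) * (N (o6 3) (o6 1) = N (o6 1) (o6 3)) *
  (N (o6 3) (o6 2) = N (o6 2) (o6 3)) *
  (N (o6 4) (o6 0) = N (o6 0) (o6 4)) * (N (o6 4) (o6 1) = N (o6 1) (o6 4)) *
  (N (o6 4) (o6 2) = N (o6 2) (o6 4)) *
  (N (o6 4) (o6 3) = N (o6 3) (o6 4)) * (N (o6 5) (o6 0) = N (o6 0) (o6 5)) *
  (N (o6 5) (o6 1) = N (o6 1) (o6 5)) *
  (N (o6 5) (o6 2) = N (o6 2) (o6 5)) * (N (o6 5) (o6 3) = N (o6 3) (o6 5)) *
  (N (o6 5) (o6 4) = N (o6 4) (o6 5)).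
Proof. by move=> Ns; do !split; rewrite -[in LHS]Ns mxE. Qed.

(** * Quadrics through the Veronese surface *)

(* The action on quadratic forms: [veron (x *m h) = veron x *m sym2 h], where
   the [i]-th coordinate of [veron x] is [x_(p i) * x_(q i)]. *)
Definition sym2_coef (R : comNzRingType) (h : 'M[R]_3) (i j : nat) : R :=
  let p := [:: 0; 1; 2%:R; 0; 1; 0] in
  let q := [:: 0; 1; 2%:R; 1; 2%:R; 2%:R] in
  if (i < 3)%N then h p`_i p`_j * h p`_i q`_j
  else h p`_i p`_j * h q`_i q`_j + h q`_i p`_j * h p`_i q`_j.

Definition sym2 (R : comNzRingType) (h : 'M[R]_3) : 'M[R]_6 :=
  \matrix_(i < 6, j < 6) sym2_coef h i j.

(* Twice the matrix of the quadratic form [tr (C * adj Y)] for a symmetric [C],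
   where [Y] is the symmetric matrix with entries [Y00, Y11, Y22, Y01, Y12, Y02]
   in the order of the coordinates of [veron]. *)
Definition minors_coef (R : comNzRingType) (C : 'M[R]_3) (i j : nat) : R :=
  (nth [::] [:: [:: 0; C 2%:R 2%:R; C 1 1; 0; - (C 1 2%:R *+ 2); 0];
      [:: C 2%:R 2%:R; 0; C 0 0; 0; 0; - (C 0 2%:R *+ 2)];
      [:: C 1 1; C 0 0; 0; - (C 0 1 *+ 2); 0; 0];
      [:: 0; 0; - (C 0 1 *+ 2); - (C 2%:R 2%:R *+ 2); C 0 2%:R *+ 2; C 1 2%:R *+ 2];
      [:: - (C 1 2%:R *+ 2); 0; 0; C 0 2%:R *+ 2; - (C 0 0 *+ 2); C 0 1 *+ 2];
      [:: 0; - (C 0 2%:R *+ 2); 0; C 1 2%:R *+ 2; C 0 1 *+ 2; - (C 1 1 *+ 2)]] i)`_j.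

Definition minors (R : comNzRingType) (C : 'M[R]_3) : 'M[R]_6 :=
  \matrix_(i < 6, j < 6) minors_coef C i j.

Lemma sym2M (R : comNzRingType) (h g : 'M[R]_3) :
  sym2 (h *m g) = sym2 h *m sym2 g.
Proof.
apply/matrixP; elim/ord6P; elim/ord6P.
all: rewrite mulmx6E !mxE /sym2_coef /= !mxE !big_ord3; ring.
Qed.

(** The adjugate, that is, the transpose of the matrix of cofactors, written out for use with
    [ring]. *)
Definition cof3 (R : comNzRingType) (h : 'M[R]_3) : 'M[R]_3 :=
  mxs 3 3
  [:: [:: h 1 1 * h 2%:R 2%:R - h 1 2%:R * h 2%:R 1;
          h 0 2%:R * h 2%:R 1 - h 0 1 * h 2%:R 2%:R;
          h 0 1 * h 1 2%:R - h 0 2%:R * h 1 1];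
      [:: h 1 2%:R * h 2%:R 0 - h 1 0 * h 2%:R 2%:R;
          h 0 0 * h 2%:R 2%:R - h 0 2%:R * h 2%:R 0;
          h 0 2%:R * h 1 0 - h 0 0 * h 1 2%:R];
      [:: h 1 0 * h 2%:R 1 - h 1 1 * h 2%:R 0;
          h 0 1 * h 2%:R 0 - h 0 0 * h 2%:R 1;
          h 0 0 * h 1 1 - h 0 1 * h 1 0]].

Definition det3 (R : comNzRingType) (h : 'M[R]_3) : R :=
  (h *m cof3 h) 0 0.

Lemma mul_cof3 (R : comNzRingType) (h : 'M[R]_3) : h *m cof3 h = (det3 h)%:M.
Proof.
apply/matrixP; elim/ord3P; elim/ord3P;
  rewrite /det3 !mxE ?big_ord3 ?mxE /= ?mulr1n ?mulr0n; ring.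
Qed.

Lemma det3M (R : comNzRingType) (h g : 'M[R]_3) :
  det3 (h *m g) = det3 h * det3 g.
Proof.
rewrite /det3 !mxE ?big_ord3 ?mxE /= ?mxE ?big_ord3.
ring.
Qed.

Lemma det3_neq0 (k : fieldType) (h : 'M[k]_3) : h \in unitmx -> det3 h != 0.
Proof.
move=> hu; apply: contraTneq isT => d0.
have := det3M h (invmx h); rewrite mulmxV // d0 mul0r.
rewrite /det3 !mxE ?big_ord3 ?mxE /= ?mxE /= => /eqP.
by rewrite !(mul0r, mul1r, mulr0, subr0, addr0) oner_eq0.
Qed.

(** In terms of symmetric matrices, [sym2 h] is Y -> h^T Y h. Since adj (h^T Y h) = adj h adj Y (adj
    h)^T, cyclicity of the trace moves the outer factors onto C. *)
Lemma sym2_minors (R : comNzRingType) (h C : 'M[R]_3) : C^T = C ->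
  sym2 h *m minors C *m (sym2 h)^T = minors ((cof3 h)^T *m C *m cof3 h).
Proof.
move=> Cs.
have [e1 e2 e3] : [/\ C 1 0 = C 0 1, C 2%:R 0 = C 0 2%:R & C 2%:R 1 = C 1 2%:R].
  by split; rewrite -[in LHS]Cs mxE.
set D := _ *m C *m _.
have DE (i j : 'I_3) : D i j =
    \sum_(k < 3) (\sum_(l < 3) cof3 h l i * C l k) * cof3 h k j.
  rewrite mxE; apply: eq_bigr => l _; rewrite mxE; congr (_ * _).
  by apply: eq_bigr => m _; rewrite mxE.
apply/matrixP => i j; rewrite (congr6E (sym2_coef h) (minors_coef C)) [RHS]mxE.
elim/ord6P: i; elim/ord6P: j.
all: rewrite /sym2_coef /minors_coef /= !(mulr0, mul0r, addr0, add0r).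
all: rewrite ?DE ?big_ord3 ?mxE /= ?e1 ?e2 ?e3.
all: ring.
Qed.

Lemma veron_mul (R : comNzRingType) (x : 'rV[R]_3) (h : 'M[R]_3) :
  veron (x *m h) = veron x *m sym2 h.
Proof.
apply/rowP; elim/ord6P; rewrite [RHS]mxE big_ord6 !mxE /sym2_coef /= ?mxE ?big_ord3; ring.
Qed.

Lemma liftmxM (k : fieldType) m n p (A : 'M[k]_(m, n)) (B : 'M[k]_(n, p)) :
  liftmx (A *m B) = liftmx A *m liftmx B.
Proof. exact: (map_mxM (mpolyC 3 (R := k))). Qed.

Lemma liftmx_tr (k : fieldType) m n (A : 'M[k]_(m, n)) : liftmx A^T = (liftmx A)^T.
Proof. by rewrite /liftmx map_trmx. Qed.

Lemma liftmxZ (k : fieldType) m n (c : k) (A : 'M[k]_(m, n)) :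
  liftmx (c *: A) = c%:MP_[3] *: liftmx A.
Proof. exact: (map_mxZ (mpolyC 3 (R := k))). Qed.

Lemma liftmx_sym2 (k : fieldType) (h : 'M[k]_3) : liftmx (sym2 h) = sym2 (liftmx h).
Proof.
apply/matrixP; elim/ord6P; elim/ord6P; rewrite !mxE /sym2_coef /= !mxE;
  by rewrite ?mpolyCD ?mpolyCM.
Qed.

(** Position j + 5l holds the coefficient of the quartic monomial with v-degree j and w-degree l;
    the zeros fill the positions that no quartic monomial reaches. *)
Lemma veron_quadric_coef (k : fieldType) (N : 'M[k]_6) : N^T = N ->
  veron (Xrow k) *m liftmx N *m (veron (Xrow k))^T = 0 ->
  forall e, [::
   N (o6 0) (o6 0); N (o6 0) (o6 3) *+ 2; N (o6 0) (o6 1) *+ 2 + N (o6 3) (o6 3);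
   N (o6 1) (o6 3) *+ 2; N (o6 1) (o6 1);
   N (o6 0) (o6 5) *+ 2; (N (o6 0) (o6 4) + N (o6 3) (o6 5)) *+ 2;
   (N (o6 1) (o6 5) + N (o6 3) (o6 4)) *+ 2; N (o6 1) (o6 4) *+ 2; 0;
   N (o6 0) (o6 2) *+ 2 + N (o6 5) (o6 5); (N (o6 2) (o6 3) + N (o6 4) (o6 5)) *+ 2;
   N (o6 1) (o6 2) *+ 2 + N (o6 4) (o6 4); 0; 0;
   N (o6 2) (o6 5) *+ 2; N (o6 2) (o6 4) *+ 2; 0; 0; 0; N (o6 2) (o6 2)]`_e = 0.
Proof.
move=> Ns E e; set s := (X in X`_e); rewrite -coef_Poly.
suff -> : Poly s = 0 by rewrite coef0.
(* The substitution [u = 1, v = x, w = x^5] separates the quartic monomials. *)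
pose x := polyX k.
pose K : P3 k -> {poly k} := mmap polyC (fun i : 'I_3 => [:: 1; x; x ^+ 5]`_i).
pose p := \row_(i < 6) [:: 1; x ^+ 2; x ^+ 10; x; x ^+ 6; x ^+ 5]`_i.
have {}E : p *m map_mx polyC N *m p^T = 0 :> 'M[{poly k}]_1.
  move/(congr1 (map_mx K)): E; rewrite !map_mxM -map_trmx map_mx0 => <-.
  have -> : map_mx K (veron (Xrow k)) = p.
    apply/rowP; elim/ord6P; rewrite !mxE /= /K ?rmorphM ?rmorphXn /= !mmapX !mmap1U /=;
      ring.
  congr (_ *m _ *m _); rewrite -map_mx_comp; apply: eq_map_mx => y /=.
  by rewrite /K mmapC.
move/(congr1 (fun A : 'M[{poly k}]_1 => A 0 0)): E.
rewrite (quad6E (nth 0 _)) !mxE => E.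
have PolyC c t : Poly (c :: t) = Poly t * x + c%:P by rewrite -cons_poly_def.
rewrite /s !PolyC (_ : Poly [::] = 0) // {s PolyC}.
move: E; rewrite {K p}/x /= => E; apply: etrans E.
rewrite !(sym6E Ns); ring.
Qed.

(** The 15 coefficient equations leave six of the 21 entries of [N] free, and these six determine
    the entries of [C]. *)
Lemma veron_quadric_minors (k : fieldType) (N : 'M[k]_6) :
  2%:R != 0 :> k -> N^T = N ->
  veron (Xrow k) *m liftmx N *m (veron (Xrow k))^T = 0 ->
  exists2 C : 'M[k]_3, C^T = C & N = 2^-1 *: minors C.
Proof.
move=> two0 Ns /(veron_quadric_coef Ns) E.
have half x : x *+ 2 = 0 -> x = 0 :> k.
  by move=> /eqP; rewrite -mulr_natr mulf_eq0 (negPf two0) orbF => /eqP.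
have [/= x00 /half x03 /(canRL (addKr _)) x33 /half x13] :=
  And4 (E 0%N) (E 1%N) (E 2%N) (E 3%N).
have [/= x11 /half x05 /half /(canRL (addrK _)) x04 /half /(canRL (addrK _)) x15] :=
  And4 (E 4%N) (E 5%N) (E 6%N) (E 7%N).
have [/half x14 /(canRL (addKr _)) x55 /half /(canRL (addrK _)) x23 /(canRL (addKr _)) x44] :=
  And4 (E 8%N) (E 10%N) (E 11%N) (E 12%N).
have [/half x25 /half x24 /= x22] := And3 (E 15%N) (E 16%N) (E 20%N).
exists (mxs 3 3
  [:: [:: N (o6 1) (o6 2) *+ 2; N (o6 4) (o6 5); N (o6 3) (o6 4)];
      [:: N (o6 4) (o6 5); N (o6 0) (o6 2) *+ 2; N (o6 3) (o6 5)];
      [:: N (o6 3) (o6 4); N (o6 3) (o6 5); N (o6 0) (o6 1) *+ 2]]).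
  by apply/matrixP; elim/ord3P; elim/ord3P; rewrite !mxE.
apply/matrixP; elim/ord6P; elim/ord6P; rewrite !mxE /minors_coef /= ?mxE /=.
all: rewrite ?(sym6E Ns) ?(x00, x03, x33, x13, x11, x05, x04, x15).
all: rewrite ?(x14, x55, x23, x44, x25, x24, x22).
all: by field.
Qed.

Lemma minorsZ (R : comNzRingType) (c : R) (C : 'M[R]_3) : minors (c *: C) = c *: minors C.
Proof.
by apply/matrixP; elim/ord6P; elim/ord6P; rewrite !mxE /minors_coef /= ?mxE; ring.
Qed.

Lemma sym2_1 (R : comNzRingType) : sym2 1%:M = 1%:M :> 'M[R]_6.
Proof.
by apply/matrixP; elim/ord6P; elim/ord6P; rewrite !mxE /sym2_coef /= ?mxE /=; ring.
Qed.

Lemma sym2_unit (k : fieldType) (h : 'M[k]_3) : h \in unitmx -> sym2 h \in unitmx.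
Proof.
move=> hu; apply: (proj1 (mulmx1_unit (_ : sym2 h *m sym2 (invmx h) = 1%:M))).
by rewrite -sym2M mulmxV // sym2_1.
Qed.

(** For h the inverse of P^T, adj h = det h P^T, so by [sym2_minors] the coordinate change h turns C
    into (det h)^2 P C P^T. *)
Lemma minors_cong (k : fieldType) (C D : 'M[k]_3) : C^T = C -> cong C D ->
  exists h e, [/\ h \in unitmx, e != 0 &
    sym2 h *m minors C *m (sym2 h)^T = e *: minors D].
Proof.
move=> Cs [P Pu <-]; exists (invmx P^T), (det3 (invmx P^T) ^+ 2).
have hu : invmx P^T \in unitmx by rewrite unitmx_inv unitmx_tr.
split=> //; first by rewrite expf_neq0 ?det3_neq0.
rewrite sym2_minors // -minorsZ; congr minors.
have -> : cof3 (invmx P^T) = det3 (invmx P^T) *: P^T.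
  by rewrite -mul_mx_scalar -mul_cof3 mulmxA mulmxV ?mul1mx ?unitmx_tr.
by rewrite [(_ *: _)^T]linearZ /= trmxK -!scalemxAl -!scalemxAr scalerA expr2.
Qed.

Lemma minors_dg_neq0 (k : fieldType) (s : seq k) : minors (dg 3 s) \in unitmx ->
  [/\ s`_0 != 0, s`_1 != 0 & s`_2 != 0].
Proof.
rewrite unitmxE unitfE => du.
have row0 i : (forall j, minors (dg 3 s) i j = 0) -> False.
  by move=> z; case/eqP: du; rewrite (expand_det_row _ i) big1 // => j _; rewrite z mul0r.
split; apply/eqP => z; [apply: (row0 (o6 4))|apply: (row0 (o6 5))|apply: (row0 (o6 3))];
  elim/ord6P; rewrite !mxE /minors_coef /= ?mxE /= ?z; ring.
Qed.

Definition psimx_coef (k : fieldType) (a b : k) (i j : nat) : k :=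
  (nth [::]
  [:: [:: 1]; [:: 0; 0; 0; 0; 0; 1]; [:: a; 0; 0; 0; 1; b]; [:: 0; 1];
      [:: 0; 0; 1]; [:: 0; 0; 0; 1]] i)`_j.

Definition psimx (k : fieldType) (a b : k) : 'M[k]_6 :=
  \matrix_(i < 6, j < 6) psimx_coef a b i j.

Lemma psiE (k : fieldType) (a b : k) : psi a b = veron (Xrow k) *m liftmx (psimx a b).
Proof.
apply/rowP; elim/ord6P; rewrite [RHS]mxE big_ord6 !mxE /psimx_coef /= ?mxE;
  rewrite ?mpolyC0 ?mpolyC1; ring.
Qed.

Lemma psimx_unit (k : fieldType) (a b : k) : psimx a b \in unitmx.
Proof.
pose B' : 'M[k]_6 := \matrix_(i < 6, j < 6) (nth [::]
  [:: [:: 1]; [:: 0; 0; 0; 1]; [:: 0; 0; 0; 0; 1]; [:: 0; 0; 0; 0; 0; 1];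
      [:: - a; - b; 1]; [:: 0; 1]] i)`_j.
apply: (proj1 (mulmx1_unit (_ : psimx a b *m B' = 1%:M))).
apply/matrixP; elim/ord6P; elim/ord6P; rewrite mxE big_ord6 !mxE /psimx_coef /=; ring.
Qed.

(** Expanding (Y00 + a Y22)(Y11 + b Y22) - Y01^2 - a Y12^2 - b Y02^2 - ab Y22^2, the terms in Y22^2
    cancel and tr (diag (a, b, 1) adj Y) remains. *)
Lemma psimx_Qab (k : fieldType) (a b : k) : 2%:R != 0 :> k ->
  psimx a b *m Qab a b *m (psimx a b)^T = 2^-1 *: minors (dg 3 [:: a; b; 1]).
Proof.
move=> two0.
pose Q i j := (nth [::]
  [:: [:: 0; 0; 0; 0; 0; 2^-1]; [:: 0; - 1]; [:: 0; 0; - a];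
      [:: 0; 0; 0; - b]; [:: 0; 0; 0; 0; - (a * b)]; [:: 2^-1]] i)`_j.
have -> : Qab a b = \matrix_(i < 6, j < 6) Q i j.
  apply/matrixP; elim/ord6P; elim/ord6P; rewrite !mxE /=.
  all: rewrite ?oppr0 //.
apply/matrixP => i j; rewrite (congr6E (psimx_coef a b) Q) [RHS]mxE [minors _ _ _]mxE.
elim/ord6P: i; elim/ord6P: j; rewrite /Q /psimx_coef /minors_coef /= ?mxE /= ?mulr1n ?mulr0n.
all: by field.
Qed.

Lemma psi_on_quadric (k : fieldType) (a b : k) : 2%:R != 0 :> k ->
  on_quadric (Qab a b) (psi a b).
Proof.
move=> two0; apply/matrixP => i j; rewrite !ord1 [RHS]mxE.
rewrite /psi (quad6E (nth 0 _)) !mxE /= !mpolyCN mpolyCM mpolyC0 mpolyC1.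
have hh : (2^-1)%:MP_[3] + (2^-1)%:MP_[3] = 1 :> P3 k.
  by rewrite -mpolyCD -mulr2n -[X in X%:MP_[_]]mulr_natr mulVf // mpolyC1.
set h := (2^-1)%:MP_[3] in hh *.
set u := 'X_0; set v := 'X_1; set w := 'X_2%:R.
(* On the image of [psi], the sum x1^2 + a x2^2 + b x3^2 + ab x4^2 factors as x0 x5, while the two
   corner entries contribute (h + h) x0 x5. *)
transitivity ((h + h - 1) * ((u ^+ 2 + a%:MP_[3] * w ^+ 2) * (v ^+ 2 + b%:MP_[3] * w ^+ 2))).
  ring.
by rewrite hh subrr mul0r.
Qed.

(** * Similarity of the quadrics Q_{a,b} *)

Section Ternary.
Variable k : fieldType.
Hypothesis two_neq0 : 2%:R != 0 :> k.

Lemma Qab_cong_dg (a b c : k) : a != 0 -> b != 0 -> c != 0 ->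
  cong (c *: Qab a b)
       (dg 6 [:: 1; -1; - c; - (c * a); - (c * b); - (c * (a * b))]).
Proof.
move=> a0 b0 c0.
(* The first two rows of [T] split the hyperbolic plane c x0 x5 as <1, -1>, which no longer depends
   on c and can therefore be cancelled. *)
pose T i j := (nth [::]
  [:: [:: 1; 0; 0; 0; 0; c^-1]; [:: 1; 0; 0; 0; 0; - c^-1]; [:: 0; 1]; [:: 0; 0; 1];
      [:: 0; 0; 0; 1]; [:: 0; 0; 0; 0; 1]] i)`_j.
pose Q i j := (nth [::]
  [:: [:: 0; 0; 0; 0; 0; c / 2]; [:: 0; - c]; [:: 0; 0; - (c * a)];
      [:: 0; 0; 0; - (c * b)]; [:: 0; 0; 0; 0; - (c * (a * b))]; [:: c / 2]] i)`_j.
have -> : c *: Qab a b = \matrix_(i < 6, j < 6) Q i j.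
  apply/matrixP; elim/ord6P; elim/ord6P; rewrite !mxE /=.
  all: rewrite ?oppr0 ?mulr0 ?mulrN ?mulr1 //.
apply: (@cong_of_mul _ _ (\matrix_(i < 6, j < 6) T i j)).
  by apply: dg_unit; rewrite //= ?(oppr_eq0, oner_eq0, mulf_eq0, negb_or) ?a0 ?b0 ?c0.
apply/matrixP => i j; rewrite (congr6E T Q) mxE mxE.
elim/ord6P: i; elim/ord6P: j; rewrite /T /Q /= ?mulr1n ?mulr0n;
  rewrite ?(mulr0, mul0r, addr0, add0r, mulr1, mul1r) //.
all: by field; rewrite c0 two_neq0.
Qed.

(* The rows of [L] are [x, i x, j x, k x] in the quaternion algebra with
   [i^2 = -a], [j^2 = -b], whose norm form is [<1, a, b, ab>]. *)
Lemma quaternion_mul (a b x0 x1 x2 x3 : k) :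
  let n := x0 ^+ 2 + a * x1 ^+ 2 + b * x2 ^+ 2 + a * b * x3 ^+ 2 in
  let L := mxs 4 4
    [:: [:: x0; x1; x2; x3]; [:: - (a * x1); x0; - (a * x3); x2];
        [:: - (b * x2); b * x3; x0; - x1];
        [:: - (a * b * x3); - (b * x2); a * x1; x0]] in
  L *m dg 4 [:: 1; a; b; a * b] *m L^T = n *: dg 4 [:: 1; a; b; a * b].
Proof.
move=> n L; apply/matrixP => i j.
rewrite mxE /dg mul_mx_diag !big_ord_recr big_ord0 /= !mxE /n.
by case: i => [[|[|[|[|//]]]] ?]; case: j => [[|[|[|[|//]]]] ?] /=; ring.
Qed.

(** The left form represents -1, so N = <1, a, b, ab> takes a value n with c n = 1. Multiplicativity
    gives N = n N up to isometry, hence -c N = -N, and <-1> cancels. *)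
Lemma pfister_cancel (a b a' b' c : k) :
  a != 0 -> b != 0 -> c != 0 ->
  cong (dg 4 [:: -1; - a'; - b'; - (a' * b')])
       (dg 4 [:: - c; - (c * a); - (c * b); - (c * (a * b))]) ->
  cong (dg 3 [:: - a'; - b'; - (a' * b')]) (dg 3 [:: - a; - b; - (a * b)]).
Proof.
move=> a0 b0 c0 e.
suff e1 : cong (dg 4 [:: -1; - a'; - b'; - (a' * b')])
               (dg 4 [:: -1; - a; - b; - (a * b)]).
  by apply: dg_cancel e1; rewrite //= ?(oppr_eq0, oner_eq0, mulf_eq0, negb_or) ?a0 ?b0 ?c0.
apply: cong_trans (e) _; case/cong_sym: e => S _ /matrixP/(_ 0 0).
rewrite mxE /dg mul_mx_diag !big_ord_recr big_ord0 /= !mxE /= -/(dg _ _).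
move: (S _ _) (S _ _) (S _ _) (S _ _) => x3 x2 x1 x0; rewrite mulr1n => e.
have := quaternion_mul a b x0 x1 x2 x3; set n := _ + _; set L := mxs _ _ _ => /= eL.
have en : c * n = 1 by apply: oppr_inj; rewrite -e /n; ring.
have dgZ (d : k) : dg 4 [:: - d; - (d * a); - (d * b); - (d * (a * b))] =
    - d *: dg 4 [:: 1; a; b; a * b].
  apply/matrixP => i j; rewrite !mxE.
  by case: i => [[|[|[|[|//]]]] ?] /=; case: (_ == j); rewrite ?mulr1n ?mulr0n; ring.
apply: (@cong_of_mul _ _ L).
  by apply: dg_unit; rewrite //= ?(oppr_eq0, oner_eq0, mulf_eq0, negb_or) ?a0 ?b0 ?c0.
rewrite -/(dg 4 _); have := dgZ 1; rewrite !mul1r => ->.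
by rewrite dgZ -scalemxAr -scalemxAl eL scalerA mulNr en.
Qed.

(** Modulo squares, -b = -(ab) a and -a = -(ab) b, so the isometry exchanges the first two
    coordinates and rescales them. *)
Lemma ternary_scaled (a b : k) : a != 0 -> b != 0 ->
  cong (dg 3 [:: - a; - b; - (a * b)]) (- (a * b) *: dg 3 [:: a; b; 1]).
Proof.
move=> a0 b0; apply: (@cong_of_mul _ _ (mxs 3 3 [:: [:: 0; a]; [:: b]; [:: 0; 0; 1]])).
  rewrite unitmxZ ?unitfE ?oppr_eq0 ?mulf_neq0 //.
  by apply: dg_unit; rewrite //= ?(oppr_eq0, oner_eq0, mulf_eq0, negb_or) ?a0 ?b0.
apply/matrixP => i j.
rewrite mxE /dg mul_mx_diag !big_ord_recr big_ord0 /= !mxE.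
by case: i => [[|[|[|//]]] ?]; case: j => [[|[|[|//]]] ?] /=; ring.
Qed.

Lemma Qab_similar_ternary (a b a' b' c : k) :
  a != 0 -> b != 0 -> a' != 0 -> b' != 0 -> c != 0 ->
  cong (Qab a' b') (c *: Qab a b) ->
  exists2 e, e != 0 & cong (dg 3 [:: a'; b'; 1]) (e *: dg 3 [:: a; b; 1]).
Proof.
move=> a0 b0 a'0 b'0 c0 h.
have q1 := Qab_cong_dg a'0 b'0 (oner_neq0 k); rewrite scale1r !mul1r in q1.
have h1 := cong_trans (cong_sym q1) (cong_trans h (Qab_cong_dg a0 b0 c0)).
have n2 : all (fun x => x != 0) [:: - c; - (c * a); - (c * b); - (c * (a * b))].
  by rewrite //= ?(oppr_eq0, oner_eq0, mulf_eq0, negb_or) ?a0 ?b0 ?c0.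
have n1 : all (fun x => x != 0) [:: -1; - c; - (c * a); - (c * b); - (c * (a * b))].
  by rewrite //= ?(oppr_eq0, oner_eq0, mulf_eq0, negb_or) ?a0 ?b0 ?c0.
have h3 := pfister_cancel a0 b0 c0
  (dg_cancel two_neq0 erefl n2 (dg_cancel two_neq0 erefl n1 h1)).
(* [h4] below relates the ternary forms scaled by -a'b' and by -ab; dividing by -a'b' gives this
   factor. *)
exists ((a' * b')^-1 * (a * b)); first by rewrite !mulf_neq0 ?invr_neq0 ?mulf_neq0.
have h4 := cong_trans (cong_sym (ternary_scaled a'0 b'0))
  (cong_trans h3 (ternary_scaled a0 b0)).
by have := congZ (- (a' * b')^-1) h4; rewrite !scalerA !mulrNN
  mulVf ?mulf_neq0 // scale1r.
Qed.
End Ternary.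

(** * Normal form and uniqueness *)

Lemma quadric_minors_ternary (k : fieldType) (N : 'M[k]_6) :
  2%:R != 0 :> k -> N^T = N -> N \in unitmx ->
  veron (Xrow k) *m liftmx N *m (veron (Xrow k))^T = 0 ->
  exists C : 'M[k]_3, [/\ C^T = C, N = 2^-1 *: minors C &
    exists a b d, [/\ a != 0, b != 0, d != 0 & cong C (d *: dg 3 [:: a; b; 1])]].
Proof.
move=> two0 Ns Nu /(veron_quadric_minors two0 Ns)[C Cs NC].
exists C; split=> //; have [s Cds] := cong_diag two0 Cs.
have [h [e [hu e0 he]]] := minors_cong Cs Cds.
have /minors_dg_neq0[s0 s1 s2] : minors (dg 3 s) \in unitmx.
  rewrite -(unitmxZ _ (_ : e \is a GRing.unit)) ?unitfE // -he !unitmx_mul unitmx_tr.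
  rewrite sym2_unit //= andbT.
  by rewrite -(unitmxZ _ (_ : 2^-1 \is a GRing.unit)) ?unitfE ?invr_eq0 // -NC.
(* Dividing by the last diagonal entry normalises it to 1. *)
exists (s`_0 / s`_2), (s`_1 / s`_2), s`_2; split; rewrite ?mulf_neq0 ?invr_eq0 //.
suff <- : dg 3 s = s`_2 *: dg 3 [:: s`_0 / s`_2; s`_1 / s`_2; 1] by [].
apply/matrixP => i j; rewrite !mxE; case: (i == j); rewrite ?mulr1n ?mulr0n ?mulr0 //.
by case: i => [[|[|[|//]]] ?] /=; field.
Qed.

Lemma ternary_psimx (k : fieldType) (C : 'M[k]_3) (a b d : k) :
  2%:R != 0 :> k -> C^T = C -> d != 0 -> cong C (d *: dg 3 [:: a; b; 1]) ->
  exists h e, [/\ h \in unitmx, e != 0 &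
    sym2 h *m (2^-1 *: minors C) *m (sym2 h)^T =
    e *: (psimx a b *m Qab a b *m (psimx a b)^T)].
Proof.
move=> two0 Cs d0 /(minors_cong Cs)[h [e [hu e0 he]]].
exists h, (e * d); split; rewrite ?mulf_neq0 //.
rewrite -scalemxAr -scalemxAl he psimx_Qab // minorsZ !scalerA.
by congr (_ *: _); ring.
Qed.

(** Pulling the quadric back along [A] replaces any Veronese surface by the standard one. *)
Lemma veron_quadricE (k : fieldType) (M A : 'M[k]_6) :
  on_quadric M (veron (Xrow k) *m liftmx A) <->
  veron (Xrow k) *m liftmx (A *m M *m A^T) *m (veron (Xrow k))^T = 0.
Proof. by rewrite /on_quadric trmx_mul !liftmxM liftmx_tr !mulmxA. Qed.

Theorem theorem8 (k : fieldType) (hk : 2 \notin [pchar k]) :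
  (forall M : 'M[k]_6, M^T = M -> \det M != 0 ->
     ((exists f : 'rV[P3 k]_6, is_veronese f /\ on_quadric M f) <->
      (exists a b : k, a != 0 /\ b != 0 /\
         exists (T : 'M[k]_6) (c : k), T \in unitmx /\ c != 0 /\
           T *m M *m T^T = c *: Qab a b)))
  /\
  (forall a b : k, a != 0 -> b != 0 ->
     is_veronese (psi a b) /\ on_quadric (Qab a b) (psi a b) /\
     forall A : 'M[k]_6, A \in unitmx ->
       on_quadric (Qab a b) (veron (Xrow k) *m liftmx A) ->
       exists (h : 'M[k]_3) (T : 'M[k]_6), h \in unitmx /\ preserves (Qab a b) T /\
         veron (Xrow k *m liftmx h) *m liftmx A *m liftmx T = psi a b).
Proof.
have two0 : 2%:R != 0 :> k by move: hk; rewrite inE.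
(* Shared by both halves: existence uses the similarity of [M] with some [Qab a b], uniqueness also
   the ternary form [C]. *)
have normal (M A : 'M[k]_6) : M^T = M -> M \in unitmx -> A \in unitmx ->
    on_quadric M (veron (Xrow k) *m liftmx A) ->
    exists C : 'M[k]_3, [/\ C^T = C, A *m M *m A^T = 2^-1 *: minors C &
      exists a b d e, [/\ a != 0, b != 0, d != 0, e != 0 &
        cong C (d *: dg 3 [:: a; b; 1]) /\ cong M (e *: Qab a b)]].
  move=> Ms Mu Au /veron_quadricE MA.
  have [||C [Cs CM [a [b [d [a0 b0 d0 Cd]]]]]] := quadric_minors_ternary two0 _ _ MA.
  - by rewrite !trmx_mul trmxK Ms mulmxA.
  - by rewrite !unitmx_mul unitmx_tr Au Mu.
  exists C; split=> //; have [h [e [hu e0 he]]] := ternary_psimx two0 Cs d0 Cd.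
  exists a, b, d, e; split=> //; split=> //.
  (* The chain goes from [M] to its pullback along [A], then by [sym2 h] to the multiple by [e] of
     the pullback of [Qab a b] along [psimx a b]. *)
  apply: cong_trans (_ : cong _ (A *m M *m A^T)) _; first by exists A.
  apply: cong_trans (_ : cong _ (e *: (psimx a b *m Qab a b *m (psimx a b)^T))) _.
    by exists (sym2 h); rewrite ?sym2_unit // CM.
  by apply/congZ/cong_sym; exists (psimx a b); rewrite ?psimx_unit.
split=> [M Ms Md|a b a0 b0].
  have Mu : M \in unitmx by rewrite unitmxE unitfE.
  split=> [[f [[A [Au ->]] fM]]|[a [b [a0 [b0 [T [c [Tu [c0 TM]]]]]]]]].
    have [C [_ _ [a [b [d [e [a0 b0 _ e0 [_ [T Tu TM]]]]]]]]] := normal M A Ms Mu Au fM.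
    by exists a, b; do 2!split=> //; exists T, e.
  (* The map [T] carries points of [Qab a b] to points of [M], so it carries the surface [psi a b]
     onto [M]. *)
  exists (veron (Xrow k) *m liftmx (psimx a b *m T)); split.
    by exists (psimx a b *m T); rewrite unitmx_mul psimx_unit.
  have := psi_on_quadric a b two0; rewrite psiE => /veron_quadricE Q0.
  apply/veron_quadricE; rewrite trmx_mul.
  have -> : psimx a b *m T *m M *m (T^T *m (psimx a b)^T) =
            c *: (psimx a b *m Qab a b *m (psimx a b)^T).
    by rewrite scalemxAl scalemxAr -TM !mulmxA.
  by rewrite liftmxZ -scalemxAr -scalemxAl Q0 scaler0.
split; first by exists (psimx a b); rewrite psimx_unit psiE.
split; first exact: psi_on_quadric.
move=> A Au AQ.
have Qs : (Qab a b)^T = Qab a b.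
  by apply/matrixP; elim/ord6P; elim/ord6P; rewrite !mxE.
have Qu : Qab a b \in unitmx.
  have := Qab_cong_dg two0 a0 b0 (oner_neq0 k); rewrite scale1r => /cong_sym/cong_unit; apply.
  by apply: dg_unit; rewrite //= ?(oppr_eq0, oner_eq0, mulf_eq0, negb_or) ?a0 ?b0.
(* The parameters [a'], [b'] found for the given surface may differ from [a], [b]; similarity of the
   two quadrics makes their ternary forms similar. *)
have [C [Cs CA [a' [b' [d [e [a'0 b'0 d0 e0 [Cd QQ]]]]]]]] := normal _ _ Qs Qu Au AQ.
have [||g g0 gd] := @Qab_similar_ternary _ two0 a b a' b' e^-1 a0 b0 a'0 b'0.
- by rewrite invr_eq0.
- by have := congZ e^-1 (cong_sym QQ); rewrite scalerA mulVf // scale1r.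
have {gd}Cg : cong C ((d * g) *: dg 3 [:: a; b; 1]).
  by apply: cong_trans Cd _; rewrite -scalerA; apply: congZ.
have [h [c [hu c0 hc]]] := ternary_psimx two0 Cs (mulf_neq0 d0 g0) Cg.
have SAu : sym2 h *m A \in unitmx by rewrite unitmx_mul sym2_unit.
(* [T] is the solution of [sym2 h *m A *m T = psimx a b]. It preserves the quadric because
   [sym2 h *m A] and [psimx a b] pull [Qab a b] back to proportional matrices. *)
exists h, (invmx (sym2 h *m A) *m psimx a b); split=> //; split; last first.
  rewrite veron_mul -liftmx_sym2 -!mulmxA -!liftmxM mulmxA mulmxA mulmxV //.
  by rewrite mul1mx psiE.
split; first by rewrite unitmx_mul unitmx_inv SAu psimx_unit.
exists c^-1; rewrite invr_eq0; split=> //.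
set S := sym2 h *m A in SAu *.
have SQ : S *m Qab a b *m S^T = c *: (psimx a b *m Qab a b *m (psimx a b)^T).
  by rewrite -hc -CA /S trmx_mul !mulmxA.
clearbody S; rewrite trmx_mul.
have -> : invmx S *m psimx a b *m Qab a b *m ((psimx a b)^T *m (invmx S)^T) =
  invmx S *m (psimx a b *m Qab a b *m (psimx a b)^T) *m (invmx S)^T by rewrite !mulmxA.
have -> : psimx a b *m Qab a b *m (psimx a b)^T = c^-1 *: (S *m Qab a b *m S^T).
  by rewrite SQ scalerA mulVf // scale1r.
have SV : S^T *m (invmx S)^T = 1%:M by rewrite -trmx_mul mulVmx // trmx1.
by rewrite -scalemxAr -scalemxAl -!mulmxA SV mulmx1 mulmxA mulVmx // mul1mx.
Qed.
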